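(* Let $n \geq 3$ be an integer and let $K_n$ be the complete graph on the vertex set $[n]=\{1,\dots,n\}$. Then the $(n-2)$-matching complex $M_{n-2}(K_n)$ is homotopy equivalent to a wedge of $n-1$ spheres, each of dimension $t=\binom{n-1}{2}-1$: $$M_{n-2}(K_n)\simeq \bigvee_{n-1}\mathbb{S}^{t}.$$
   Context: For an integer $r\geq 1$ and a finite simple graph $G$, a subset $H\subseteq E(G)$ of edges is an $r$-matching if every vertex of $G$ has degree at most $r$ in the subgraph with vertex set $V(G)$ and edge set $H$. The $r$-matching complex $M_r(G)$ is the abstract simplicial complex whose vertex set is $E(G)$ and whose faces are all $r$-matchings of $G$ (including the empty set); it is regarded as a topological space via its geometric realization. $K_n$ has all edges $\{i,j\}$ with $1\le i<j\le n$. *)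

(* Defs.v *)
From HB Require Import structures.
From mathcomp Require Import all_boot all_order all_algebra.

Set Implicit Arguments.
Unset Strict Implicit.
Unset Printing Implicit Defensive.

Record sgraph := SGraph {
  vertex :> finType;
  adj : rel vertex;
  adj_sym : symmetric adj;
  adj_irr : irreflexive adj }.

Definition edges (G : sgraph) : {set {set G}} :=
  [set [set p.1; p.2] | p : G * G & adj p.1 p.2].

Definition edge (G : sgraph) : finType := {e : {set G} | e \in edges G}.

Lemma neq_sym (T : eqType) : symmetric (fun x y : T => x != y).
Proof. by move=> x y; rewrite eq_sym. Qed.

Lemma neq_irr (T : eqType) : irreflexive (fun x y : T => x != y).
Proof. by move=> x; rewrite eqxx. Qed.

Definition complete_graph (n : nat) : sgraph :=
  SGraph (@neq_sym 'I_n) (@neq_irr 'I_n).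

Definition degree (G : sgraph) (H : {set edge G}) (v : G) : nat :=
  #|[set e in H | v \in val e]|.

Definition r_matching (G : sgraph) (r : nat) (H : {set edge G}) : bool :=
  [forall v, degree H v <= r].

(* A point of [V] is a vertex only if its singleton is a face; for the r-matching
   complex with 0 < r every edge is one, see [matching_complex1]. *)
Record simplicial_complex (V : finType) := SimplicialComplex {
  face : {set {set V}};
  face0 : set0 \in face;
  face_sub : forall s t : {set V}, s \subset t -> t \in face -> s \in face }.

Section MatchingComplex.
Variables (r : nat) (G : sgraph).

Definition r_matchings : {set {set edge G}} := [set H | r_matching r H].

Lemma r_matchings0 : set0 \in r_matchings.
Proof.
rewrite inE; apply/forallP => v; rewrite /degree (_ : [set _ in _ | _] = set0).
  by rewrite cards0.
by apply/setP => e; rewrite !inE.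
Qed.

Lemma r_matchings_sub (H K : {set edge G}) :
  H \subset K -> K \in r_matchings -> H \in r_matchings.
Proof.
move=> /subsetP HK; rewrite !inE => /forallP Kr; apply/forallP => v.
apply: leq_trans (Kr v); apply: subset_leq_card.
by apply/subsetP => e; rewrite !inE => /andP[/HK -> ->].
Qed.

Definition matching_complex : simplicial_complex (edge G) :=
  SimplicialComplex r_matchings0 r_matchings_sub.

Lemma matching_complex1 (e : edge G) :
  0 < r -> [set e] \in face matching_complex.
Proof.
move=> r0; rewrite inE; apply/forallP => v; apply: leq_trans r0.
rewrite -(cards1 e); apply: subset_leq_card.
by apply/subsetP => f; rewrite inE => /andP[].
Qed.

End MatchingComplex.

From mathcomp Require Import all_classical all_reals all_analysis homotopy.
Import Order.TTheory GRing.Theory Num.Theory.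
Import numFieldNormedType.Exports.

Local Open Scope classical_set_scope.
Local Open Scope ring_scope.

(* Points given by their barycentric coordinates; [V] is finite, so the topology
   induced by the product topology of R^V is the usual (coherent) one. *)
Definition barycentric (R : realType) (V : finType) (K : simplicial_complex V)
    : set {ptws V -> R} :=
  [set x | [/\ forall v, 0 <= x v, \sum_v x v = 1 &
               finset (fun v => x v != 0) \in face K]].
Arguments barycentric : clear implicits.
Arguments barycentric R {V} K.

Definition realization (R : realType) (V : finType) (K : simplicial_complex V)
    : topologicalType := set_type (barycentric R K).

Definition sphere (R : realType) (t : nat) : set 'rV[R]_t.+1 :=
  [set x | \sum_i x ord0 i ^+ 2 = 1].
Arguments sphere : clear implicits.

Lemma sphere_delta (R : realType) (t : nat) :
  delta_mx ord0 ord0 \in sphere R t.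
Proof.
rewrite inE /sphere /= (bigD1 ord0) //= big1 ?addr0; first by rewrite mxE expr1n.
by move=> i i0; rewrite mxE (negbTE i0) andbF expr0n.
Qed.

Definition sphere_point (R : realType) (t : nat) : sphere R t :=
  SigSub (sphere_delta R t).

(* Meant for 0 < k: for k = 0 this is the empty space, not a point. *)
Definition wedge_of_spheres (R : realType) (k t : nat) : topologicalType :=
  wedge (fun _ : 'I_k => sphere_point R t).

Definition homotopic (R : realType) (X Y : topologicalType) (f g : X -> Y) :=
  exists H : X * R -> Y,
    [/\ {within [set: X] `*` `[0, 1], continuous H},
        forall x, H (x, 0) = f x & forall x, H (x, 1) = g x].

Definition homotopy_equivalent (R : realType) (X Y : topologicalType) :=
  exists (f : X -> Y) (g : Y -> X),
    [/\ continuous f, continuous g,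
        homotopic R (g \o f) idfun & homotopic R (f \o g) idfun].

(* Main.v *)
Require Import Defs.
From mathcomp Require Import all_boot all_order all_algebra.
From mathcomp Require Import all_classical all_reals all_analysis homotopy.
From mathcomp Require Import ring lra zify.

(** A face is a set of edges containing no full star. For each vertex [v], the
    set [F_v] of the edges avoiding [v] is a facet with [binom (n-1) 2] elements.
    Fix a vertex [z] and let [A] be the complex with the [n-1] open facets [F_v],
    [v <> z], removed. Collapsing [A] sends each of these facets onto a sphere, so
    the quotient is the wedge; it remains to contract [A] inside the complex by a
    homotopy that starts at the identity and preserves [A].

    Write [a_i] for the coordinate of the edge [iz] and [b_ij] for the others.
    First decrease all coordinates by [s], truncating at 0, while increasing some
    [b_ij] as follows. If two of the [a_i] are smaller than [s], increase the
    corresponding [b_ij]. If all [a_i] but [a_v] are nonzero, increase [b_vj]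
    whenever some [b_jk] with [k <> v] is smaller than [s]. No star is completed,
    and the resulting [b] is nonzero unless the point lies well inside a facet
    [F_v] with [v <> z]. Then shrink [a] to 0, which leaves a point of the simplex
    [F_z], and contract that simplex. A cutoff function stops this second stage in
    the interior of the facets [F_v], [v <> z]. *)

Set Implicit Arguments.
Unset Strict Implicit.
Unset Printing Implicit Defensive.
Import Order.TTheory GRing.Theory Num.Theory.
Import numFieldNormedType.Exports.
Local Open Scope classical_set_scope.
Local Open Scope ring_scope.

(** * Homotopy equivalences from quotient maps *)

Lemma pair_continuous (S T U : topologicalType) (f : S -> T) (g : S -> U) :
  continuous f -> continuous g -> continuous (fun x => (f x, g x)).
Proof. by move=> cf cg x; apply: cvg_pair; [exact: cf|exact: cg]. Qed.

Lemma comp_continuous (S T U : topologicalType) (f : S -> T) (g : T -> U) :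
  continuous f -> continuous g -> continuous (fun x => g (f x)).
Proof. by move=> cf cg x; apply: continuous_comp; [exact: cf|exact: cg]. Qed.

Section Quotient.
Variables (X Y : topologicalType) (q : X -> Y).
Hypotheses (Xcompact : compact [set: X]) (Yhausdorff : hausdorff_space Y).
Hypotheses (q_continuous : continuous q) (q_surj : forall y, exists x, q x = y).

(** A quotient map times an identity map need not be a quotient map; compactness supplies a tube
    argument instead. Points of the fibre over [y] use the continuity of [F], and the image of any
    other [x] is separated from [y], so nothing is asked near it. *)
Lemma quotient_lift_continuous (T Z : topologicalType)
    (F : X * T -> Z) (G : Y * T -> Z) :
  continuous F -> (forall x t, G (q x, t) = F (x, t)) -> continuous G.
Proof.
move=> Fcont GF [y t] W; rewrite nbhs_simpl /= => GW.
have nW : \forall p \near (y, t), forall x, q x = p.1 -> W (F (x, p.2)).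
  suff: \forall p \near (y, t), [set: X] `<=` (fun x => q x = p.1 -> W (F (x, p.2))).
    by apply: filterS => p Wp x; exact: Wp.
  apply: (iffLR (compact_near_coveringP _) Xcompact _ (nbhs (y, t))
    (fun p x => q x = p.1 -> W (F (x, p.2)))) => x _.
  have [qxy|/eqP qxy] := pselect (q x = y).
    move: GW; rewrite -qxy GF => /Fcont[/= [U V] [/= xU tV] UV].
    exists (U, [set p | V p.2]) => /=; first by split=> //; exact: cvg_snd.
    by case=> x' [y' t'] /= [Ux' Vt'] _; exact: (UV (x', t')).
  move: Yhausdorff; rewrite open_hausdorff => /(_ _ _ qxy)[[U V] /=].
  rewrite !inE => -[Uqx Vy] [oU oV UV0].
  exists (q @^-1` U, [set p | V p.1]) => /=.
    split; first exact/q_continuous/open_nbhs_nbhs.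
    by apply: cvg_fst; exact: open_nbhs_nbhs.
  case=> x' [y' t'] /= [Ux' Vy'] qx'y'.
  have : (U `&` V) y' by split=> //; rewrite -qx'y'.
  by rewrite UV0.
apply: filterS nW => -[y' t'] /= Wx'.
by have [x qx] := q_surj y'; rewrite -qx GF; exact: Wx'.
Qed.

Variables (R : realType) (A : set X) (H : X * R -> X).
Hypothesis qE : forall x x', q x = q x' <-> x = x' \/ A x /\ A x'.
Hypothesis H_continuous : continuous H.
Hypothesis H0 : forall x, H (x, 0) = x.
Hypothesis HA : forall x s, A x -> A (H (x, s)).
Hypothesis H1 : forall x x', A x -> A x' -> H (x, 1) = H (x', 1).

(* The inverse of [q] is the end of the homotopy, which descends to the quotient;
   the homotopy itself descends because it preserves [A]. *)
Lemma quotient_homotopy_equivalent : homotopy_equivalent R X Y.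
Proof.
pose r y := projT1 (cid (q_surj y)).
have rK y : q (r y) = y by rewrite /r; case: cid.
have rqE x s : q (H (r (q x), s)) = q (H (x, s)).
  apply/qE; have /qE[->|[Ax Ax']] := rK (q x); [by left|right].
  by split; exact: HA.
pose g y := H (r y, 1).
have gq x : g (q x) = H (x, 1).
  by rewrite /g; have /qE[->//|[Ax Ax']] := rK (q x); exact: H1.
have Hs1 (s : R) : continuous (fun x => H (x, s)).
  apply: (@comp_continuous _ _ _ (fun x => (x, s)) H) => //.
  by apply: pair_continuous => x; [exact: cvg_id|exact: cvg_cst].
(* [homotopic] wants the identity at time 1, so [H] is run backwards. *)
have HV : continuous (fun p : X * R => H (p.1, 1 - p.2)).
  apply: (@comp_continuous _ _ _ (fun p : X * R => (p.1, 1 - p.2)) H) => //.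
  apply: pair_continuous => p; first exact: cvg_fst.
  by apply: (@cvgB R R^o); [exact: cvg_cst|exact: cvg_snd].
exists q, g; split => //.
- have gc : continuous (fun p : Y * R => g p.1).
    apply: (@quotient_lift_continuous _ _ (fun p => H (p.1, 1))) => [|x t] /=.
      by apply: (@comp_continuous _ _ _ fst _ _ (Hs1 1)) => p; exact: cvg_fst.
    exact: gq.
  apply: (@comp_continuous _ _ _ (fun y => (y, 0 : R)) (fun p => g p.1)) => //.
  by apply: pair_continuous => y; [exact: cvg_id|exact: cvg_cst].
- exists (fun p => H (p.1, 1 - p.2)); split => /= [|x|x].
  + exact: continuous_subspaceT.
  + by rewrite subr0 gq.
  + by rewrite subrr H0.
- exists (fun p => q (H (r p.1, 1 - p.2))); split => /= [|y|y].
  + apply: continuous_subspaceT.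
    apply: (@quotient_lift_continuous R Y (fun p => q (H (p.1, 1 - p.2)))
      (fun p => q (H (r p.1, 1 - p.2)))).
      exact: (comp_continuous HV).
    by move=> x t /=; rewrite rqE.
  + by rewrite subr0.
  + by rewrite subrr H0 rK.
Qed.
End Quotient.

(** * Collapsing the boundary of a simplex onto a sphere *)

Section SimplexToSphere.
Variables (R : realType) (V : finType) (t : nat) (en : 'I_t.+1 -> V).
Implicit Types (x : V -> R).

(** The default 1 is harmless because barycentric coordinates are at most 1. *)
Definition inradius x := \big[Num.min/1]_j x (en j).

Definition offset x j := x (en j) - x (en ord0).

Definition outer_mass x := \sum_(v | v \notin codom en) x v.

Definition spread x := \sum_j offset x j ^+ 2 + outer_mass x ^+ 2.

(* Inverse stereographic projection of [offset x / inradius x]. The outer mass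
   only serves to keep the denominator away from 0 off the facet. *)
Definition collapse_row x : 'rV[R]_t.+1 :=
  \row_j ((if j == ord0 then spread x - inradius x ^+ 2
           else 2 * inradius x * offset x j) / (spread x + inradius x ^+ 2)).

Hypothesis en_inj : injective en.

Lemma sum_codom x : \sum_v x v = \sum_j x (en j) + outer_mass x.
Proof.
rewrite (bigID (mem (codom en))) /=; congr (_ + _).
have en_uniq : uniq (codom en) by exact/injectiveP.
by rewrite -big_uniq //= codomE big_map enumT.
Qed.

Section Point.
Variable (x : V -> R).
Hypotheses (x_ge0 : forall v, 0 <= x v) (x_sum : \sum_v x v = 1).

Lemma coord_le1 v : x v <= 1.
Proof. by rewrite -x_sum (bigD1 v) //= lerDl sumr_ge0. Qed.

Lemma inradius_ge0 : 0 <= inradius x.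
Proof. by apply: le_bigmin. Qed.

Lemma inradius_le j : inradius x <= x (en j).
Proof. exact: bigmin_le. Qed.

Lemma inradius_attained : exists j, inradius x = x (en j).
Proof.
have [j _ xj] := @eq_bigmin _ _ _ 1 ord0 xpredT (x \o en) isT
  (fun j _ => coord_le1 (en j)).
by exists j.
Qed.

Lemma inradius_gt0 : 0 < inradius x <-> forall j, 0 < x (en j).
Proof.
split=> [x0 j|x0]; first exact: lt_le_trans (inradius_le j).
by apply: lt_bigmin.
Qed.

Lemma spread_ge0 : 0 <= spread x.
Proof. by rewrite addr_ge0 ?sqr_ge0 // sumr_ge0 // => j _; exact: sqr_ge0. Qed.

(** If both terms vanished, the coordinates on the facet would all equal their minimum 0 and the
    outer mass would be 0, against the total mass 1. *)
Lemma collapse_den_gt0 : 0 < spread x + inradius x ^+ 2.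
Proof.
rewrite lt0r addr_ge0 ?spread_ge0 ?sqr_ge0 // andbT.
apply: contra_eq_neq x_sum => /eqP.
rewrite paddr_eq0 ?spread_ge0 ?sqr_ge0 // => /andP[].
rewrite paddr_eq0 ?sqr_ge0 ?sumr_ge0 // => [|j _]; last exact: sqr_ge0.
rewrite psumr_eq0 => [/andP[/allP off0]|j _]; last exact: sqr_ge0.
rewrite !expf_eq0 /= => /eqP out0 /eqP rad0.
have [j0 radE] := inradius_attained.
have xE j : x (en j) = x (en ord0).
  by have := off0 j (mem_index_enum _); rewrite expf_eq0 /= subr_eq0 => /eqP.
rewrite sum_codom out0 addr0 big1 1?eq_sym ?oner_eq0 // => j _.
by rewrite xE -(xE j0) -radE.
Qed.

Lemma sum_offset : \sum_j offset x j ^+ 2 = \sum_(j | j != ord0) offset x j ^+ 2.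
Proof. by rewrite (bigD1 ord0) //= /offset subrr expr0n add0r. Qed.

Lemma collapse_row_boundary : inradius x = 0 -> collapse_row x = delta_mx ord0 ord0.
Proof.
move=> rad0; apply/rowP => j; rewrite !mxE eqxx /=.
have := collapse_den_gt0; rewrite rad0 expr0n /= subr0 addr0 mulr0 mul0r => den0.
by have [_|_] := eqVneq j ord0; rewrite ?mul0r ?divff ?gt_eqF.
Qed.

Hypothesis facet : 0 < inradius x -> forall v, v \notin codom en -> x v = 0.

Lemma facet_outer_mass : 0 < inradius x -> outer_mass x = 0.
Proof. by move=> /facet x0; apply: big1 => v; exact: x0. Qed.

(** With spread S and inradius r, (S - r^2)^2 + 4 r^2 S = (S + r^2)^2. The row has the squared
    offsets in place of the second S; the difference is the squared outer mass, which vanishes when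
    r > 0. *)
Lemma collapse_row_sphere : collapse_row x \in sphere R t.
Proof.
rewrite inE /sphere /=; have den0 := collapse_den_gt0.
have radout : inradius x * outer_mass x = 0.
  have [->|rad0] := eqVneq (inradius x) 0; first by rewrite mul0r.
  by rewrite facet_outer_mass ?mulr0 // lt0r rad0 inradius_ge0.
rewrite (bigD1 ord0) //= mxE eqxx.
under eq_bigr => j j0 do rewrite mxE (negbTE j0) expr_div_n exprMn.
rewrite -mulr_suml -mulr_sumr -sum_offset expr_div_n -mulrDl.
apply: (canLR (mulfK _)); first by rewrite sqrf_eq0 gt_eqF.
have -> : \sum_j offset x j ^+ 2 = spread x - outer_mass x ^+ 2.
  by rewrite /spread addrK.
have -> : (2 * inradius x) ^+ 2 * (spread x - outer_mass x ^+ 2) =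
  4 * inradius x ^+ 2 * spread x - 4 * (inradius x * outer_mass x) ^+ 2 by ring.
by rewrite radout; ring.
Qed.

Lemma collapse_row_apex : 1 - collapse_row x ord0 ord0 =
  2 * inradius x ^+ 2 / (spread x + inradius x ^+ 2).
Proof.
rewrite mxE eqxx; have den0 := gt_eqF collapse_den_gt0.
by field; rewrite den0.
Qed.

Lemma collapse_row_eq_delta :
  collapse_row x = delta_mx ord0 ord0 -> inradius x = 0.
Proof.
move=> /rowP/(_ ord0)/(congr1 (fun a => 1 - a)).
rewrite collapse_row_apex mxE eqxx subrr => /eqP.
rewrite !mulf_eq0 invr_eq0 (gt_eqF collapse_den_gt0) orbF pnatr_eq0 /=.
by rewrite orbb => /eqP.
Qed.

(** Stereographic projection from the pole recovers the offsets up to the scale [inradius x]. *)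
Lemma offset_ratio j : 0 < inradius x ->
  offset x j / inradius x = if j == ord0 then 0
    else collapse_row x ord0 j / (1 - collapse_row x ord0 ord0).
Proof.
move=> rad0; have [->|j0] := eqVneq j ord0; first by rewrite /offset subrr mul0r.
rewrite collapse_row_apex mxE (negbTE j0).
have den0 := gt_eqF collapse_den_gt0.
by field; rewrite den0 gt_eqF.
Qed.

End Point.

(** The image determines the offsets divided by the inradius. The smallest facet coordinate divided
    by the inradius is 1, which fixes all such quotients, and the total mass 1 then fixes the
    inradius. *)
Lemma collapse_row_inj x y :
  (forall v, 0 <= x v) -> \sum_v x v = 1 ->
  (0 < inradius x -> forall v, v \notin codom en -> x v = 0) ->
  (forall v, 0 <= y v) -> \sum_v y v = 1 ->
  (0 < inradius y -> forall v, v \notin codom en -> y v = 0) ->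
  0 < inradius x -> 0 < inradius y -> collapse_row x = collapse_row y -> x =1 y.
Proof.
move=> x0 x1 xF y0 y1 yF rx ry xy.
have ratio j : offset x j / inradius x = offset y j / inradius y.
  by rewrite !offset_ratio // xy.
have coordE z j : 0 < inradius z ->
    z (en j) / inradius z = z (en ord0) / inradius z + offset z j / inradius z.
  by move=> rz; rewrite /offset -mulrDl addrC subrK.
have apex_le z w : (forall v, 0 <= z v) -> \sum_v z v = 1 ->
    0 < inradius z -> 0 < inradius w ->
    (forall j, offset z j / inradius z = offset w j / inradius w) ->
    z (en ord0) / inradius z <= w (en ord0) / inradius w.
  move=> z0 z1 rz rw zw; have [j rzE] := inradius_attained z0 z1.
  rewrite -(lerD2r (offset z j / inradius z)) -coordE // zw -coordE //.
  by rewrite -rzE divff ?gt_eqF // ler_pdivlMr // mul1r inradius_le.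
have apexE : x (en ord0) / inradius x = y (en ord0) / inradius y.
  by apply: le_anti; rewrite !apex_le.
have xyE j : x (en j) / inradius x = y (en j) / inradius y.
  by rewrite coordE // apexE ratio -coordE.
have radE : inradius x = inradius y.
  apply: invr_inj; rewrite -[LHS]mul1r -[RHS]mul1r -{1}x1 -y1 !sum_codom.
  rewrite !facet_outer_mass // !addr0 !mulr_suml.
  exact: eq_bigr.
move=> v; have [/codomP[j ->]|vF] := boolP (v \in codom en); last first.
  by rewrite xF ?yF.
by move: (xyE j); rewrite radE => /(mulIf _) -> //; rewrite invr_eq0 gt_eqF.
Qed.

(** The stereographic projection [y] of [p], shifted to have minimum 1 and divided by the resulting
    total [W], has inradius 1/W and offsets y/W. *)
Lemma collapse_row_surj (p : 'rV[R]_t.+1) :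
  p \in sphere R t -> p != delta_mx ord0 ord0 ->
  exists x, [/\ forall v, 0 <= x v, \sum_v x v = 1,
    forall j, 0 < x (en j), forall v, v \notin codom en -> x v = 0 &
    collapse_row x = p].
Proof.
rewrite inE /sphere /= (bigD1 ord0) //= => p1 pNdelta.
have p_lt1 : p ord0 ord0 < 1.
  have sum_ge0 : 0 <= \sum_(i | i != ord0) p ord0 i ^+ 2.
    by apply: sumr_ge0 => i _; exact: sqr_ge0.
  have p_le1 : p ord0 ord0 <= 1 by nra.
  rewrite lt_neqAle p_le1 andbT; apply: contra pNdelta => /eqP p01.
  move: p1; rewrite p01 expr1n => /(canRL (addKr _)); rewrite addNr => /eqP.
  rewrite psumr_eq0 => [/allP psum0|i _]; last exact: sqr_ge0.
  apply/eqP/rowP => j; rewrite mxE eqxx /=; have [->//|j0] := eqVneq j ord0.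
  by have := psum0 j (mem_index_enum _); rewrite j0 expf_eq0 /= => /eqP.
pose c := 1 - p ord0 ord0; have c0 : 0 < c by rewrite subr_gt0.
pose y j := if j == ord0 then 0 else p ord0 j / c.
have [jm y_min] : exists jm, forall j, y jm <= y j.
  exists [arg min_(j < ord0) y j]%O.
  by case: Order.TotalTheory.arg_minP => // i _ + j; exact.
pose w j := 1 + y j - y jm.
have w_ge1 j : 1 <= w j by rewrite /w -addrA lerDl subr_ge0.
have wm : w jm = 1 by rewrite /w addrK.
pose W := \sum_j w j.
have W0 : 0 < W.
  rewrite /W (bigD1 ord0) //= ltr_pwDl ?sumr_ge0 //; last first.
    by move=> j _; exact: le_trans (w_ge1 j).
  exact: lt_le_trans (w_ge1 _).
pose x v := if [pick j | en j == v] is Some j then w j / W else 0.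
have xen j : x (en j) = w j / W.
  rewrite /x; case: pickP => [j' /eqP/en_inj -> //|/(_ j)]; by rewrite eqxx.
have xout v : v \notin codom en -> x v = 0.
  rewrite /x; case: pickP => // j /eqP <-; by rewrite codom_f.
have x_gt0 j : 0 < x (en j).
  by rewrite xen divr_gt0 //; exact: lt_le_trans (w_ge1 j).
have out0 : outer_mass x = 0 by apply: big1.
have x_ge0 v : 0 <= x v.
  have [/codomP[j ->]|/xout ->//] := boolP (v \in codom en); exact: ltW.
have x_sum : \sum_v x v = 1.
  rewrite sum_codom out0 addr0; under eq_bigr do rewrite xen.
  by rewrite -mulr_suml divff // gt_eqF.
exists x; split => //.
have radE : inradius x = W^-1.
  apply: le_anti; apply/andP; split.
    by apply: le_trans (inradius_le _ jm) _; rewrite xen wm mul1r.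
  apply: le_bigmin => [|j _].
    apply: le_trans (coord_le1 x_ge0 x_sum (en jm)); by rewrite xen wm mul1r.
  by rewrite xen ler_pdivlMr // mulVf ?gt_eqF.
have offE j : offset x j = y j / W.
  by rewrite /offset !xen /w /y eqxx -mulrBl; congr (_ / _); ring.
have spreadE : spread x = (1 + p ord0 ord0) / c / W ^+ 2.
  rewrite /spread out0 expr0n addr0 sum_offset.
  under eq_bigr => j j0 do rewrite offE /y (negbTE j0) !expr_div_n.
  rewrite -!mulr_suml.
  have -> : \sum_(i | i != ord0) p ord0 i ^+ 2 = c * (1 + p ord0 ord0).
    by rewrite /c; apply: (addrI (p ord0 ord0 ^+ 2)); rewrite p1; ring.
  by field; rewrite !gt_eqF.
have Wn0 := gt_eqF W0; have cn0 := gt_eqF c0.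
have pE : p ord0 ord0 = 1 - c by rewrite /c; ring.
have denE : spread x + inradius x ^+ 2 = 2 / c / W ^+ 2.
  by rewrite spreadE radE pE; field; rewrite Wn0 cn0.
apply/rowP => j; rewrite mxE denE spreadE radE offE (ord1 0).
have [->|j0] := eqVneq j ord0.
  by rewrite pE; field; rewrite Wn0 cn0.
by rewrite /y (negbTE j0); field; rewrite Wn0 cn0.
Qed.

End SimplexToSphere.

(** * Continuity and compactness of realizations *)

Section RealContinuity.
Variables (R : realType) (T : topologicalType).
Implicit Types f g : T -> R.

Lemma add_cont f g : continuous f -> continuous g -> continuous (fun x => f x + g x).
Proof. by move=> cf cg x; apply: (@cvgD R R^o); [exact: cf|exact: cg]. Qed.

Lemma sub_cont f g : continuous f -> continuous g -> continuous (fun x => f x - g x).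
Proof. by move=> cf cg x; apply: (@cvgB R R^o); [exact: cf|exact: cg]. Qed.

Lemma mul_cont f g : continuous f -> continuous g -> continuous (fun x => f x * g x).
Proof. by move=> cf cg x; apply: cvgM; [exact: cf|exact: cg]. Qed.

Lemma div_cont f g : (forall x, g x != 0) ->
  continuous f -> continuous g -> continuous (fun x => f x / g x).
Proof.
move=> g0 cf cg x; apply: cvgM; first exact: cf.
by apply: cvgV; [exact: g0|exact: cg].
Qed.

Lemma sqr_cont f : continuous f -> continuous (fun x => f x ^+ 2).
Proof. by move=> cf; exact: mul_cont. Qed.

Lemma cst_cont (c : R) : continuous (fun _ : T => c).
Proof. by move=> x; exact: cvg_cst. Qed.

Lemma min_cont f g : continuous f -> continuous g ->
  continuous (fun x => Num.min (f x) (g x)).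
Proof. by move=> cf cg x; apply: continuous_min; [exact: cf|exact: cg]. Qed.

Lemma max_cont f g : continuous f -> continuous g ->
  continuous (fun x => Num.max (f x) (g x)).
Proof. by move=> cf cg x; apply: continuous_max; [exact: cf|exact: cg]. Qed.

Lemma sum_cont (I : finType) (P : pred I) (F : I -> T -> R) :
  (forall i, continuous (F i)) -> continuous (fun x => \sum_(i | P i) F i x).
Proof. by move=> cF; apply: (continuous_big (@add_continuous R^o)) => i _; exact: cF. Qed.

Lemma prod_cont (I : finType) (P : pred I) (F : I -> T -> R) :
  (forall i, continuous (F i)) -> continuous (fun x => \prod_(i | P i) F i x).
Proof. by move=> cF; apply: (continuous_big (@mul_continuous R)) => i _; exact: cF. Qed.

Lemma bigmin_cont (I : finType) (c : R) (F : I -> T -> R) :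
  (forall i, continuous (F i)) ->
  continuous (fun x => \big[Num.min/c]_i F i x).
Proof. by move=> cF; apply: (continuous_big (@min_continuous _ R)) => i _; exact: cF. Qed.

Lemma mx_cont m n (M : T -> 'M[R]_(m, n)) :
  (forall i j, continuous (fun x => M x i j)) -> continuous M.
Proof.
move=> cM x U [P MP PU].
have : \forall y \near x, forall i j, P i j (M y i j).
  by apply: filter_forall => i; apply: filter_forall => j; exact/cM/MP.
by apply: filterS => y Py; exact: PU.
Qed.

Lemma ptws_cont (V : finType) (f : T -> {ptws V -> R}) :
  (forall v, continuous (fun x => f x v)) -> continuous f.
Proof.
move=> cf x; apply/cvg_sup => v.
exact: (@continuous_comp_initial _ _ _ (@proj V (fun=> R) v) f (cf v) x).
Qed.

End RealContinuity.

Section SetType.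
Variables (T : topologicalType) (A : set T).

Lemma set_val_cont : continuous (set_val : A -> T).
Proof. exact: initial_continuous. Qed.

Lemma to_set_type_cont (S : topologicalType) (f : S -> A) :
  continuous (fun x => set_val (f x)) -> continuous f.
Proof. exact: continuous_comp_initial. Qed.

Lemma set_type_compact : compact A -> compact [set: A].
Proof.
move=> Ac F FF _.
have FA : F (set_val @^-1` A) by apply: filterS filterT => x _; exact: set_valP.
have [a [Aa aF]] := Ac (set_val @ F) _ FA.
exists (SigSub (mem_set Aa)); split=> // B C FB [_ [[W oW <-] Wa WC]].
have [] := aF (set_val @` B) W.
- suff : F (set_val @^-1` (set_val @` B)) by [].
  by apply: filterS FB => x Bx; exists x.
- exact: open_nbhs_nbhs (conj oW Wa).
by move=> _ [[x Bx <-] Wx]; exists x; split => //; exact: WC.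
Qed.

Lemma set_type_hausdorff : hausdorff_space T -> hausdorff_space A.
Proof.
move=> Th x y xy; apply: val_inj; apply: Th => U W nU nW.
have [z [Uz Wz]] := xy _ _ (set_val_cont nU) (set_val_cont nW).
by exists (set_val z).
Qed.

End SetType.

Section Realization.
Variables (R : realType) (V : finType) (K : simplicial_complex V).

(** Replaces the support condition by polynomial equations, one for each non-face, so that the
    realization is visibly closed. *)
Lemma face_supportP (x : V -> R) :
  (finset (fun v => x v != 0) \in face K) <->
  forall s, s \notin face K -> \prod_(v in s) x v = 0.
Proof.
split=> [xK s sK|xK]; last first.
  apply: contraT => /xK /eqP; rewrite prodf_seq_eq0 => /hasP[v _].
  by rewrite inE => /andP[/negP].
apply/eqP; apply: contraNT sK => /prodf_neq0 xs.
by apply: face_sub xK; apply/fintype.subsetP => v /xs; rewrite inE.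
Qed.

Lemma barycentric_compact : compact (barycentric R K).
Proof.
have projc v : continuous (fun x : {ptws V -> R} => x v) by exact: proj_continuous.
have cube : compact [set x : {ptws V -> R} | forall v, [set a : R | a \in `[0, 1]] (x v)].
  apply: (@tychonoff V (fun=> R) (fun=> [set a | a \in `[0, 1]])) => v.
  exact: segment_compact.
apply: subclosed_compact cube _; last first.
  move=> x [x0 x1 _] v /=; rewrite in_itv /= x0 /=.
  exact: coord_le1.
have -> : barycentric R K = \bigcap_v [set x | 0 <= x v] `&`
  ([set x | \sum_v x v = 1] `&` \bigcap_(s in [set s | s \notin face K])
     [set x | \prod_(v in s) x v = 0]).
  apply/seteqP; split=> x.
    by case=> x0 x1 /face_supportP xK; split=> [v _|]; [exact: x0|split=> // s /xK].
  by case=> x0 [x1 xK]; split=> // [v|]; [exact: x0|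
    exact: (iffRL (face_supportP x) xK)].
apply: closedI; last apply: closedI.
- apply: closed_bigI => v _.
  exact: (iffLR (continuous_closedP _) (projc v) _ (@closed_ge R 0)).
- exact: (iffLR (continuous_closedP _) (sum_cont (P := xpredT) projc) _ (@closed_eq R 1)).
- apply: closed_bigI => s _.
  exact: (iffLR (continuous_closedP _) (prod_cont (P := mem s) projc) _ (@closed_eq R 0)).
Qed.

Lemma realization_compact : compact [set: realization R K].
Proof. exact/set_type_compact/barycentric_compact. Qed.

End Realization.

(** * Complexes that contract after removing some facets *)

Section WedgeOfFacets.
Variables (R : realType) (V : finType) (K : simplicial_complex V) (k t : nat).
Variable en : 'I_k -> 'I_t.+1 -> V.
Hypothesis k_gt0 : (0 < k)%N.
Hypothesis en_inj : forall i, injective (en i).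
Hypothesis en_face : forall i, [set v in codom (en i)]%SET \in face K.
Hypothesis en_facet : forall i s, s \in face K ->
  (forall j, en i j \in s) -> s = [set v in codom (en i)]%SET.
Hypothesis en_distinct : forall i i',
  (forall j, en i j \in codom (en i')) -> i = i'.

Local Notation X := (realization R K).
Local Notation Y := (wedge_of_spheres R k t).
Implicit Types (x : X) (i : 'I_k).

Let lift i : sphere R t -> Y := @wedge_lift _ _ (fun _ : 'I_k => sphere_point R t) i.

(** What remains after removing the [k] open facets; it becomes the [A] of the quotient
    criterion. *)
Definition facet_boundary : set X :=
  [set x | forall i, exists j, set_val x (en i j) = 0].

Local Lemma X_ge0 x v : 0 <= set_val x v.
Proof. by have [x0 _ _] := @set_valP _ (barycentric R K) x; exact: x0. Qed.

Local Lemma X_sum x : \sum_v set_val x v = 1.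
Proof. by have [] := @set_valP _ (barycentric R K) x. Qed.

Local Lemma X_support x : finset (fun v => set_val x v != 0) \in face K.
Proof. by have [] := @set_valP _ (barycentric R K) x. Qed.

Local Lemma X_facet x i : 0 < inradius (en i) (set_val x) ->
  forall v, v \notin codom (en i) -> set_val x v = 0.
Proof.
move=> /inradius_gt0 rad v vF.
apply/eqP; apply: contraNT vF => xv.
suff : v \in [set v in codom (en i)]%SET by rewrite inE.
rewrite -(en_facet (X_support x)) ?inE // => j.
by rewrite inE gt_eqF.
Qed.

Local Lemma X_disjoint x i i' : 0 < inradius (en i) (set_val x) ->
  0 < inradius (en i') (set_val x) -> i = i'.
Proof.
move=> /inradius_gt0 rad rad'.
apply: en_distinct => j; apply: contraTT (rad j) => /(X_facet rad') ->.
by rewrite ltxx.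
Qed.

Definition sphere_map i x : sphere R t :=
  SigSub (collapse_row_sphere (@en_inj i) (X_ge0 x) (X_sum x) (@X_facet x i)).

Lemma sphere_map_boundary i x :
  sphere_map i x = sphere_point R t <-> inradius (en i) (set_val x) = 0.
Proof.
split=> [/(congr1 val)/= h|h].
  exact: (collapse_row_eq_delta (@en_inj i) (X_ge0 x) (X_sum x) h).
apply: val_inj => /=.
exact: (collapse_row_boundary (@en_inj i) (X_ge0 x) (X_sum x) h).
Qed.

Lemma coord_cont v : continuous (fun x : X => set_val x v).
Proof.
have h1 := @set_val_cont _ (barycentric R K).
have h2 : continuous (fun x : {ptws V -> R} => x v) := @proj_continuous V (fun=> R) v.
exact: comp_continuous h1 h2.
Qed.

Lemma inradius_cont i : continuous (fun x : X => inradius (en i) (set_val x)).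
Proof.
apply: bigmin_cont => j.
exact: coord_cont.
Qed.

Lemma sphere_map_cont i : continuous (sphere_map i).
Proof.
apply: to_set_type_cont.
have coord := coord_cont.
have off j : continuous (fun x : X => offset (en i) (set_val x) j) by exact: sub_cont.
have spr : continuous (fun x : X => spread (en i) (set_val x)).
  apply: add_cont; first by apply: sum_cont => j; exact: sqr_cont.
  by apply: sqr_cont; exact: sum_cont.
have rad := @inradius_cont i.
apply: mx_cont => a j.
rewrite (_ : (fun x => _) = fun x : X =>
  (if j == ord0 then spread (en i) (set_val x) - inradius (en i) (set_val x) ^+ 2
   else 2 * inradius (en i) (set_val x) * offset (en i) (set_val x) j) /
  (spread (en i) (set_val x) + inradius (en i) (set_val x) ^+ 2)); last first.
  by apply: funext => x; rewrite mxE.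
apply: div_cont; last 1 first.
- by apply: add_cont => //; exact: sqr_cont.
- by move=> x; rewrite gt_eqF // collapse_den_gt0 //; [exact: X_ge0|exact: X_sum].
have [_|_] := eqVneq j ord0; first by apply: sub_cont => //; exact: sqr_cont.
by apply: mul_cont => //; apply: mul_cont => //; exact: cst_cont.
Qed.

(** At most one [i] qualifies, by [X_disjoint]; if none does, the value is the common base point,
    written in the first sphere. *)
Definition facet_collapse x : Y :=
  if [pick i | 0 < inradius (en i) (set_val x)] is Some i
  then lift i (sphere_map i x) else lift (Ordinal k_gt0) (sphere_point R t).

Let lift_point i i' : lift i (sphere_point R t) = lift i' (sphere_point R t).
Proof. exact: (@wedge_liftE _ _ (fun _ : 'I_k => sphere_point R t) i' (sphere_point R t)
  i (sphere_point R t)). Qed.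

Lemma facet_collapse_interior x i : 0 < inradius (en i) (set_val x) ->
  facet_collapse x = lift i (sphere_map i x).
Proof.
move=> rad; rewrite /facet_collapse; case: pickP => [i' rad'|/(_ i)].
  by rewrite (X_disjoint rad rad').
by rewrite rad.
Qed.

Lemma inradius_eq0_or_gt0 x i :
  inradius (en i) (set_val x) = 0 \/ 0 < inradius (en i) (set_val x).
Proof.
have := inradius_ge0 (en i) (X_ge0 x).
by rewrite le_eqVlt => /predU1P[<-|]; [left|right].
Qed.

Lemma facet_boundaryP x :
  facet_boundary x <-> forall i, inradius (en i) (set_val x) = 0.
Proof.
split=> [Ax i|rad0 i].
  have [//|/inradius_gt0 rad] := inradius_eq0_or_gt0 x i.
  by have [j xj] := Ax i; move: (rad j); rewrite xj ltxx.
have [j rE] := inradius_attained (en i) (X_ge0 x) (X_sum x).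
by exists j; rewrite -rE.
Qed.

Lemma facet_collapse_boundary x i : facet_boundary x ->
  facet_collapse x = lift i (sphere_point R t).
Proof.
move=> /facet_boundaryP rad0; rewrite /facet_collapse.
case: pickP => [i'|_]; first by rewrite rad0 ltxx.
exact: lift_point.
Qed.

Lemma facet_collapse_lift x : exists i, facet_collapse x = lift i (sphere_map i x).
Proof.
rewrite /facet_collapse; case: pickP => [i _|rad0]; first by exists i.
exists (Ordinal k_gt0); congr lift; apply/esym/sphere_map_boundary.
by have [//|] := inradius_eq0_or_gt0 x (Ordinal k_gt0); rewrite rad0.
Qed.

(** Near a point of [facet_boundary], all [k] lifted sphere maps are close to the base point and the
    collapse equals one of them. Elsewhere one inradius stays positive nearby and selects a single
    sphere map. *)
Lemma facet_collapse_cont : continuous facet_collapse.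
Proof.
have lift_cont i : continuous (fun x => lift i (sphere_map i x)).
  have lc := @wedge_lift_continuous _ _ (fun _ : 'I_k => sphere_point R t) i.
  exact: comp_continuous (@sphere_map_cont i) lc.
move=> x U; rewrite nbhs_simpl.
have [Ax|] := pselect (facet_boundary x).
  rewrite (facet_collapse_boundary (Ordinal k_gt0) Ax) => nU.
  have : \forall x' \near x, forall i, U (lift i (sphere_map i x')).
    apply: (@filter_forall X _ (fun i x' => U (lift i (sphere_map i x'))) (nbhs x)).
    move=> i; apply: (lift_cont i x).
    have /facet_boundaryP/(_ i)/sphere_map_boundary -> := Ax.
    by rewrite (lift_point i (Ordinal k_gt0)).
  apply: filterS => x' Ux' /=.
  by have [i ->] := facet_collapse_lift x'; exact: Ux'.
move=> /facet_boundaryP/existsNP[i rad0].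
have rad : 0 < inradius (en i) (set_val x) by have [] := inradius_eq0_or_gt0 x i.
rewrite (facet_collapse_interior rad) => nU.
have near_rad : \forall x' \near x, 0 < inradius (en i) (set_val x').
  apply: (@inradius_cont i x [set r | 0 < r]).
  by apply: open_nbhs_nbhs; split => //; exact: open_gt.
move: near_rad (lift_cont i x _ nU); apply: filterS2 => x' rad' Ux' /=.
by rewrite (facet_collapse_interior rad').
Qed.

(** In the product of the spheres, the image of [p] from summand [i] has entry [p] at [i] and the
    base point elsewhere, so entries can be compared. *)
Lemma lift_eq i i' p p' : lift i p = lift i' p' ->
  (i = i' /\ p = p') \/ (p = sphere_point R t /\ p' = sphere_point R t).
Proof.
set p0 := fun _ : 'I_k => sphere_point R t.
move=> /(congr1 (@wedge_prod _ _ p0)).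
rewrite /wedge_prod /lift !wedge_lift_funE; try exact: wedge_prod_pointE.
have [<-|ii'] := eqVneq i i' => pp'.
  by left; have /(congr1 (fun f => f i)) := pp'; rewrite !dfwithin.
right; split.
  by have /(congr1 (fun f => f i)) := pp'; rewrite dfwithin dfwithout // eq_sym.
by have /(congr1 (fun f => f i')) := pp'; rewrite dfwithin dfwithout.
Qed.

Lemma facet_collapse_eq x x' : facet_collapse x = facet_collapse x' <->
  x = x' \/ facet_boundary x /\ facet_boundary x'.
Proof.
split; last first.
  case=> [->//|[Ax Ax']].
  by rewrite !(facet_collapse_boundary (Ordinal k_gt0)).
have eq_interior y y' i : 0 < inradius (en i) (set_val y) ->
    facet_collapse y = facet_collapse y' -> y = y'.
  move=> rad; rewrite (facet_collapse_interior rad).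
  have sph_neq : sphere_map i y <> sphere_point R t.
    by move=> /sphere_map_boundary; move: rad => /[swap] ->; rewrite ltxx.
  have [i' ->] := facet_collapse_lift y'.
  move=> /lift_eq[[<- ss]|[/sph_neq//]].
  have rad' : 0 < inradius (en i) (set_val y').
    have [/sphere_map_boundary|//] := inradius_eq0_or_gt0 y' i.
    by rewrite -ss.
  apply: val_inj; apply: funext.
  have := @collapse_row_inj _ _ _ _ (@en_inj i) (set_val y) (set_val y')
    (X_ge0 y) (X_sum y) (@X_facet y i) (X_ge0 y') (X_sum y') (@X_facet y' i) rad rad'.
  by apply; exact: (congr1 val ss).
move=> xx'; have [Ax|] := pselect (facet_boundary x); last first.
  move=> /facet_boundaryP/existsNP[i rad0]; left; apply: (eq_interior _ _ i) xx'.
  by have [] := inradius_eq0_or_gt0 x i.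
have [Ax'|] := pselect (facet_boundary x'); first by right.
move=> /facet_boundaryP/existsNP[i rad0]; left; apply/esym.
apply: (eq_interior _ _ i) (esym xx').
by have [] := inradius_eq0_or_gt0 x' i.
Qed.

Lemma facet_collapse_surj : facet_boundary !=set0 ->
  forall y, exists x, facet_collapse x = y.
Proof.
move=> [a Aa] y; have : [set: Y] y by [].
rewrite -wedgeTE => -[i _ [p _ <-]].
have [->|pN] := eqVneq p (sphere_point R t).
  by exists a; rewrite (facet_collapse_boundary i).
have [] := collapse_row_surj (@en_inj i) (valP p).
  by apply: contra_neq pN => pE; exact: val_inj.
move=> x [x0 x1 xpos xout xp].
have xK : x \in barycentric R K.
  rewrite inE; split => //; rewrite (_ : finset _ = [set v in codom (en i)]%SET) //.
  apply/setP => v; rewrite !inE; have [/codomP[j ->]|/xout ->] := boolP (v \in codom (en i)).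
    by rewrite gt_eqF.
  by rewrite eqxx.
exists (SigSub xK : X).
rewrite (@facet_collapse_interior _ i); last exact/inradius_gt0.
congr lift; exact: val_inj.
Qed.

(** The collapse is a continuous surjection from a compact space to a Hausdorff one, and its fibres
    are [facet_boundary] and single points. *)
Theorem wedge_of_facets (H : X * R -> X) (a : X) :
  facet_boundary a -> continuous H -> (forall x, H (x, 0) = x) ->
  (forall x s, facet_boundary x -> facet_boundary (H (x, s))) ->
  (forall x, facet_boundary x -> H (x, 1) = a) ->
  homotopy_equivalent R X Y.
Proof.
move=> Aa Hcont H0 HA H1.
apply: (@quotient_homotopy_equivalent _ _ facet_collapse _ _ _ _ _ facet_boundary H) => //.
- exact: realization_compact.
- apply: wedge_hausdorff => i; apply: set_type_hausdorff; exact: norm_hausdorff.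
- exact: facet_collapse_cont.
- by apply: facet_collapse_surj; exists a.
- exact: facet_collapse_eq.
- by move=> x x' Ax Ax'; rewrite !H1.
Qed.

End WedgeOfFacets.

(** * Edges and stars of the complete graph *)

Section CompleteGraph.
Variable m : nat.
Hypothesis m_ge2 : (2 <= m)%N.

Local Notation G := (complete_graph m.+1).
Local Notation E := (edge G).
Implicit Types (e f g : E) (u v w : 'I_m.+1).

Definition ends e : {set 'I_m.+1} := val e.

Lemma ends_inj : injective ends.
Proof. exact: val_inj. Qed.

Lemma edges_completeE (s : {set 'I_m.+1}) : (s \in edges G) = (#|s| == 2).
Proof.
apply/imsetP/cards2P => [[[v w] /=]|[v [w [vw ->]]]].
  by rewrite inE /= => vw ->; exists v, w.
by exists (v, w); rewrite ?inE.
Qed.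

Lemma edge_ex v w : v != w -> {e | ends e = [set v; w]%SET}.
Proof.
move=> vw; have ve : [set v; w]%SET \in edges G by rewrite edges_completeE cards2 vw.
by exists (@exist {set G} (fun s => s \in edges G) _ ve : E).
Qed.

Lemma ends_card e : #|ends e| = 2.
Proof. by apply/eqP; rewrite -edges_completeE; exact: (valP e). Qed.

Lemma ends_pair v w e : v != w -> v \in ends e -> w \in ends e ->
  ends e = [set v; w]%SET.
Proof.
move=> vw ve we; apply/esym/eqP; rewrite eqEcard ends_card cards2 vw andbT.
by apply/fintype.subsetP => u; rewrite !inE => /orP[] /eqP ->.
Qed.

Lemma edge_eq v w e f : v != w -> v \in ends e -> w \in ends e ->
  v \in ends f -> w \in ends f -> e = f.
Proof.
move=> vw ve we vf wf; apply: ends_inj.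
by rewrite (ends_pair vw ve we) (ends_pair vw vf wf).
Qed.

Lemma other_end v e : v \in ends e -> exists2 w, w != v & w \in ends e.
Proof.
move=> ve; have /card_gt0P[w] : (0 < #|(ends e :\ v)%SET|)%N.
  by have := cardsD1 v (ends e); rewrite ve ends_card add1n => -[<-].
by rewrite !inE => /andP[wv we]; exists w.
Qed.

Lemma end_ex e v : v \notin ends e -> exists2 w, w != v & w \in ends e.
Proof.
move=> ve; have /card_gt0P[w we] : (0 < #|ends e|)%N by rewrite ends_card.
by exists w => //; apply: contraNneq ve => <-.
Qed.

(** There are at least three vertices. [v] and [w] may coincide, so this also yields a vertex other
    than a given one. *)
Lemma third_vertex v w : exists2 u, u != v & u != w.
Proof.
have /card_gt0P[u] : (0 < #|(~: [set v; w])%SET|)%N.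
  have := cardsC [set v; w]%SET; have := cards2 v w; rewrite card_ord.
  by case: (v == w) => /=; lia.
by rewrite !inE negb_or => /andP[uv uw]; exists u.
Qed.

Lemma card_edges_avoiding v : #|[set e : E | v \notin ends e]%SET| = 'C(m, 2).
Proof.
transitivity 'C(#|[set~ v]%SET|, 2); last by rewrite cardsC1 card_ord.
rewrite -cards_draws -(card_imset _ ends_inj).
apply: eq_card => s; rewrite !inE; apply/imsetP/andP => [[e]|[sv s2]].
  rewrite inE => ve ->; rewrite ends_card eqxx; split=> //.
  apply/fintype.subsetP => w we; rewrite !inE.
  by apply: contraNneq ve => <-.
have se : s \in edges G by rewrite edges_completeE.
exists (@exist {set G} (fun s => s \in edges G) s se : E) => //; rewrite inE.
by apply/negP => /(fintype.subsetP sv); rewrite !inE eqxx.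
Qed.

Lemma card_star v : #|[set e : E | v \in ends e]%SET| = m.
Proof.
have := cardsC [set e : E | v \in ends e]%SET.
have -> : (~: [set e : E | v \in ends e])%SET = [set e : E | v \notin ends e]%SET.
  by apply/setP => e; rewrite !inE.
rewrite card_edges_avoiding card_sig.
have -> : #|[pred s in edges G]| = 'C(m.+1, 2).
  transitivity 'C(#|'I_m.+1|, 2); last by rewrite card_ord.
  rewrite -card_draws; apply: eq_card => s.
  by rewrite !inE -edges_completeE.
by rewrite binS bin1; lia.
Qed.

(** The star of [v] has [m] edges, so degree at most m - 1 at [v] means that some edge of the star
    is missing. *)
Lemma star_matchingP (H : {set E}) :
  (H \in face (matching_complex m.-1 G)) <->
  forall v, exists2 e, v \in ends e & e \notin H.
Proof.
have degE v : degree H v = #|(H :&: [set e | v \in ends e])%SET|.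
  by rewrite /degree setIdE.
rewrite inE; split=> [/forallP Hr v|Hr].
  have : ~~ ([set e : E | v \in ends e]%SET \subset H).
    apply/negP => /finset.setIidPr sH; have := Hr v.
    by rewrite degE sH card_star; lia.
  by case/fintype.subsetPn => e; rewrite inE; exists e.
apply/forallP => v; have [e ve eH] := Hr v.
suff : (degree H v < m)%N by lia.
rewrite degE -[ltnRHS](card_star v); apply: proper_card.
apply/fintype.properP; split; first exact: finset.subsetIr.
by exists e; rewrite !inE // (negbTE eH).
Qed.

End CompleteGraph.

(** * The piecewise polynomial deformation *)

Section Deformation.
Variables (R : realType) (m : nat).
Hypothesis m_ge2 : (2 <= m)%N.

Local Notation E := (edge (complete_graph m.+1)).
Implicit Types (x y : E -> R) (e f g : E) (v w : 'I_m.+1) (s u : R).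

Let z : 'I_m.+1 := ord0.

Definition star_free x := forall v, exists2 e, v \in ends e & x e = 0.

(** On top of [star_free], this describes the complex with the open facets F_v, v <> z, removed; F_z
    itself stays. *)
Definition facet_free x := forall v, v != z -> exists2 e, v \notin ends e & x e = 0.

Definition posp (a : R) := Num.max 0 a.

Definition touch e f := ~~ [disjoint ends e & ends f].

(* When [x] vanishes on some edge at [z], this is nonzero (for [v <> z]) only if the
   edge [vz] is the unique such edge. *)
Definition others v x := \prod_(f | (z \in ends f) && (v \notin ends f)) x f.

(** For an edge [e] = vj not through [z], the sum runs over the edges jk with k outside {v, z}; it
    is positive exactly when one of them is smaller than [s]. *)
Definition hollow s v e x :=
  \sum_(f | [&& z \notin ends f, v \notin ends f & touch f e]) posp (s - x f).

(* The increments of [b_e]: the sum handles a unique zero among the [a_i], the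
   product two small [a_i]. At [s = 0] both vanish. *)
Definition pushed s e x := \sum_(v in ends e) hollow s v e x * others v x +
  \prod_(f | (z \in ends f) && touch f e) posp (s - x f).

Definition thicken s e x :=
  posp (x e - s) + (if z \in ends e then 0 else pushed s e x).

(* For [u <= 1/2] the coordinates at [z] shrink to 0; for [u >= 1/2] the others move
   to the constant 1. *)
Definition deform s u e x := if z \in ends e then posp (1 - 2 * u) * thicken s e x
  else Num.min 1 (2 - 2 * u) * thicken s e x + posp (2 * u - 1).

Lemma posp_ge0 a : 0 <= posp a. Proof. by rewrite /posp le_max lexx. Qed.

Lemma posp_eq0 a : a <= 0 -> posp a = 0.
Proof. by move=> a0; rewrite /posp max_l. Qed.

Lemma posp_id a : 0 <= a -> posp a = a.
Proof. by move=> a0; rewrite /posp max_r. Qed.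

Lemma posp_gt0 a : (0 < posp a) = (0 < a).
Proof. by rewrite /posp lt_max ltxx. Qed.

Lemma touchP v e f : v \in ends e -> v \in ends f -> touch e f.
Proof.
by move=> ve vf; apply/negP => /pred0P/(_ v) /=; rewrite ve vf.
Qed.

Lemma touch_ex e f : touch e f -> exists2 v, v \in ends e & v \in ends f.
Proof. by case/pred0Pn => v /andP[ve vf]; exists v. Qed.

Lemma hollow_ge0 s v e x : 0 <= hollow s v e x.
Proof. by apply: sumr_ge0 => f _; exact: posp_ge0. Qed.

Lemma apex_edge v : exists2 e, v \in ends e & z \in ends e.
Proof.
have [->|vz] := eqVneq v z; last first.
  by have [e eE] := edge_ex vz; exists e; rewrite eE !inE eqxx ?orbT.
have [w wz _] := third_vertex m_ge2 z z.
by have [e eE] := edge_ex wz; exists e; rewrite eE !inE eqxx ?orbT.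
Qed.

Lemma avoiding_apex_edge v : v != z -> exists2 e, v \notin ends e & z \in ends e.
Proof.
move=> vz; have [w wz wv] := third_vertex m_ge2 z v.
have [e eE] := edge_ex wz; exists e; rewrite eE !inE ?eqxx ?orbT //.
by rewrite negb_or eq_sym wv.
Qed.

Lemma base_edge : exists e, z \notin ends e.
Proof.
have [v vz _] := third_vertex m_ge2 z z; have [w wz wv] := third_vertex m_ge2 z v.
have [e eE] := edge_ex wv; exists e.
by rewrite eE !inE negb_or !(eq_sym z) wz.
Qed.

Section Nonnegative.
Variable x : E -> R.
Hypothesis x_ge0 : forall e, 0 <= x e.

Lemma others_ge0 v : 0 <= others v x.
Proof. exact: prodr_ge0. Qed.

Lemma pushed_ge0 s e : 0 <= pushed s e x.
Proof.
rewrite addr_ge0 ?prodr_ge0 ?sumr_ge0 // => [v _|f _]; last exact: posp_ge0.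
by rewrite mulr_ge0 ?hollow_ge0 ?others_ge0.
Qed.

Lemma thicken_ge0 s e : 0 <= thicken s e x.
Proof.
by rewrite /thicken; case: ifP => _; rewrite addr_ge0 ?posp_ge0 ?pushed_ge0.
Qed.

Lemma deform_ge0 s u e : u <= 1 -> 0 <= deform s u e x.
Proof.
move=> u1; rewrite /deform; case: ifP => _.
  by rewrite mulr_ge0 ?posp_ge0 ?thicken_ge0.
rewrite addr_ge0 ?posp_ge0 // mulr_ge0 ?thicken_ge0 //.
by rewrite le_min ler01 /=; lra.
Qed.

Lemma deform_eq0 s u e : u <= 2^-1 -> thicken s e x = 0 -> deform s u e x = 0.
Proof.
move=> u2 te; rewrite /deform te !mulr0 add0r.
by case: ifP => // _; rewrite posp_eq0 //; lra.
Qed.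

Lemma thicken_eq0_apex s e : z \in ends e -> x e <= s -> thicken s e x = 0.
Proof. by move=> ze xs; rewrite /thicken ze addr0 posp_eq0 // subr_le0. Qed.

Lemma thicken_eq0 s e : x e <= s ->
  (forall v, v \in ends e -> hollow s v e x * others v x = 0) ->
  (exists f, [/\ z \in ends f, touch f e & s <= x f]) -> thicken s e x = 0.
Proof.
move=> xs hol [f [zf fe sf]]; rewrite /thicken posp_eq0 ?subr_le0 // add0r.
case: ifP => // _; rewrite /pushed big1 // add0r.
by rewrite (bigD1 f) /= ?zf ?fe // posp_eq0 ?mul0r ?subr_le0.
Qed.

Lemma others_eq0 v f : z \in ends f -> v \notin ends f -> x f = 0 -> others v x = 0.
Proof. by move=> zf vf xf; rewrite /others (bigD1 f) /= ?zf ?vf // xf mul0r. Qed.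

Hypothesis x_star : star_free x.

(** Some edge at [z] vanishes, and a nonzero [others v] leaves only vz for it; vz is a factor of
    [others w]. *)
Lemma others_neq0 v w : v != z -> w != v -> w != z -> others v x != 0 ->
  others w x = 0.
Proof.
move=> vz wv wz ov; have [f zf xf] := x_star z; apply: (others_eq0 zf _ xf).
have vf : v \in ends f.
  by apply: contraNT ov => vf; rewrite (others_eq0 zf vf xf).
by rewrite (ends_pair vz vf zf) !inE negb_or wv.
Qed.

(** At [z], a zero edge stays 0. At another vertex [i], the edge iz drops to 0 unless it exceeds
    [s]. In that case a zero edge at [i] can be raised only through a term of the sum at its other
    endpoint [v], which requires a further edge at [i] not exceeding [s]; that edge drops to 0
    instead. *)
Lemma thicken_star_free s : 0 <= s -> star_free (fun e => thicken s e x).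
Proof.
move=> s0 i; have [->|iz] := eqVneq i z.
  by have [e ze xe] := x_star z; exists e => //; rewrite thicken_eq0_apex ?xe.
have [a aE] := edge_ex iz.
have [ia za] : i \in ends a /\ z \in ends a by rewrite aE !inE !eqxx orbT.
have [xa|xa] := leP (x a) s; first by exists a; rewrite ?thicken_eq0_apex.
have [e ie xe] := x_star i.
have ze : z \notin ends e.
  apply: contraTN xa => ze; rewrite -(edge_eq iz ie ze ia za) xe; lra.
have apex f : i \in ends f -> exists g, [/\ z \in ends g, touch g f & s <= x g].
  by move=> fi; exists a; rewrite (touchP ia fi) ltW.
have [hol|] := pselect (forall v, v \in ends e -> hollow s v e x * others v x = 0).
  by exists e => //; apply: thicken_eq0; rewrite ?xe //; exact: apex.
move=> /existsNP[v /not_implyP[ve /eqP]]; rewrite mulf_eq0 negb_or => /andP[hv ov].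
have vz : v != z by apply: contraNneq ze => <-.
have [f /andP[/and3P[zf vf fe] sxf]] :
    exists f, [&& z \notin ends f, v \notin ends f & touch f e] && (0 < s - x f).
  apply: contrapT => /forallNP nof; move/eqP: hv; apply; apply: big1 => f fP.
  by apply: posp_eq0; have /negP := nof f; rewrite fP /= -leNgt.
(* The zero edge at [z] is not iz, so [others i] vanishes while [others v] does not. *)
have vi : v != i.
  apply: contraNneq ov => vi; have [f0 zf0 xf0] := x_star z.
  apply/eqP/(others_eq0 zf0 _ xf0); rewrite vi; apply: contraTN xa => if0.
  by rewrite -(edge_eq iz if0 zf0 ia za) xf0; lra.
have fi : i \in ends f.
  have [j jf] := touch_ex fe; rewrite (ends_pair vi ve ie) !inE.
  by case/orP => /eqP jE; move: jf; rewrite jE // (negbTE vf).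
(* [f] becomes 0 in place of [e]: it is below [s], and [others] vanishes at its endpoints, which
   differ from [v] and [z]. *)
exists f => //; apply: thicken_eq0 => [|w wf|].
- by rewrite -subr_ge0 ltW.
- rewrite (others_neq0 vz _ _ ov) ?mulr0 //.
    by apply: contraNneq vf => <-.
  by apply: contraNneq zf => <-.
- exact: apex.
Qed.

(** If some edge at [z] avoiding [v] is at most [s], it drops to 0. Otherwise the zero edge at [z]
    is vz, so [others w] vanishes for [w] other than [v] and [z], and a zero edge avoiding [v] is
    not raised. *)
Lemma thicken_facet_free s : 0 <= s -> facet_free x ->
  facet_free (fun e => thicken s e x).
Proof.
move=> s0 xF v vz; have [e ve xe] := xF v vz.
have [[f [zf vf xf]]|nof] :=
    pselect (exists f, [/\ z \in ends f, v \notin ends f & x f <= s]).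
  by exists f; rewrite ?thicken_eq0_apex.
have big f : z \in ends f -> v \notin ends f -> s < x f.
  by move=> zf vf; rewrite ltNge; apply/negP => xf; apply: nof; exists f.
have [f zf xf] := x_star z.
have vf : v \in ends f.
  by apply/negPn/negP => vf; have := big f zf vf; rewrite xf; lra.
have ze : z \notin ends e by apply/negP => ze; have := big e ze ve; rewrite xe; lra.
exists e => //; apply: thicken_eq0 => [|w we|]; first by rewrite xe.
  have wv : w != v by apply: contraNneq ve => <-.
  have wz : w != z by apply: contraNneq ze => <-.
  by rewrite (others_eq0 zf _ xf) ?mulr0 // (ends_pair vz vf zf) !inE negb_or wv.
have [j jv je] := end_ex ve; have jz : j != z by apply: contraNneq ze => <-.
have [g gE] := edge_ex jz.
have [gj gz] : j \in ends g /\ z \in ends g by rewrite gE !inE !eqxx orbT.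
exists g; rewrite gz (touchP gj je); split=> //; apply/ltW/big => //.
by rewrite gE !inE negb_or eq_sym jv.
Qed.

Lemma deform_apex_eq0 s u e : 2^-1 < u -> z \in ends e -> deform s u e x = 0.
Proof. by move=> u2 ze; rewrite /deform ze posp_eq0 ?mul0r //; lra. Qed.

(** For [u] up to 1/2 the zeros of [thicken] persist; beyond that every edge at [z] is 0, and each
    star contains such an edge. *)
Lemma deform_star_free s u : 0 <= s -> star_free (fun e => deform s u e x).
Proof.
move=> s0 v; have [u2|u2] := leP u 2^-1.
  by have [e ve te] := thicken_star_free s0 v; exists e => //; exact: deform_eq0.
by have [e ve ze] := apex_edge v; exists e => //; exact: deform_apex_eq0.
Qed.

Lemma deform_facet_free s u : 0 <= s -> facet_free x ->
  facet_free (fun e => deform s u e x).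
Proof.
move=> s0 xF v vz; have [u2|u2] := leP u 2^-1.
  have [e ve te] := thicken_facet_free s0 xF vz.
  by exists e => //; exact: deform_eq0.
have [e ve ze] := avoiding_apex_edge vz.
by exists e => //; exact: deform_apex_eq0.
Qed.

Lemma deform_id e : deform 0 0 e x = x e.
Proof.
have thickE : thicken 0 e x = x e.
  rewrite /thicken subr0 posp_id //; case: ifP => [_|/negbT ze]; first exact: addr0.
  have neg f : posp (0 - x f) = 0 by apply: posp_eq0; rewrite sub0r oppr_le0.
  rewrite /pushed big1 ?add0r => [|v _]; last by rewrite /hollow big1 ?mul0r.
  (* The product in [pushed] is not empty: an endpoint of [e] is joined to [z]. *)
  have [v _ ve] := end_ex ze; have [f vf zf] := apex_edge v.
  by rewrite (bigD1 f) /= ?zf ?(touchP vf ve) // neg mul0r addr0.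
have min1 : Num.min 1 2 = 1 :> R by apply: min_l; rewrite ler1n.
rewrite /deform thickE mulr0 subr0 subr0 sub0r; case: ifP => _.
  by rewrite posp_id // mul1r.
by rewrite min1 mul1r posp_eq0 ?addr0 // oppr_le0.
Qed.

(** The end does not depend on [x]: after normalization it is the barycenter of F_z. *)
Lemma deform_end s e : deform s 1 e x = (z \notin ends e)%:R.
Proof.
rewrite /deform; case: ifP => _ /=; first by rewrite posp_eq0 ?mul0r //; lra.
rewrite mulr1 subrr (min_r (_ : 0 <= 1)) // mul0r add0r posp_id; lra.
Qed.

(** Let vz be a zero edge. If a second edge wz is below [s], the product in [pushed] raises vw.
    Otherwise some edge jk avoiding [v] and [z] is below [s], and the sum raises vj. *)
Lemma thicken_base_gt0 s : 0 < s ->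
  (forall v, v != z -> exists2 e, v \notin ends e & x e < s) ->
  exists2 e, z \notin ends e & 0 < thicken s e x.
Proof.
move=> s0 small; have [f zf xf] := x_star z.
have [v vz vf] := other_end zf.
have push_gt0 e : z \notin ends e -> 0 < pushed s e x -> 0 < thicken s e x.
  by move=> ze pe; rewrite /thicken (negbTE ze) ltr_wpDl ?posp_ge0.
have hol_ge0 e w : 0 <= hollow s w e x * others w x.
  by rewrite mulr_ge0 ?hollow_ge0 ?others_ge0.
have [[g [zg gf xg]]|nog] :=
    pselect (exists g, [/\ z \in ends g, g != f & x g < s]).
  have [w wz wg] := other_end zg.
  have wv : w != v.
    apply: contraNneq gf => wv.
    by rewrite (edge_eq vz (_ : v \in ends g) zg vf zf) // -wv.
  have [e eE] := edge_ex wv; exists e; first by rewrite eE !inE negb_or !(eq_sym z) wz.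
  apply: push_gt0; first by rewrite eE !inE negb_or !(eq_sym z) wz.
  rewrite /pushed ltr_wpDl ?sumr_ge0 // prodr_gt0 // => h /andP[zh].
  move=> /touch_ex[j jh]; rewrite eE !inE posp_gt0 subr_gt0.
  case/orP => /eqP jE; rewrite {}jE in jh.
    by rewrite (edge_eq wz jh zh wg zg).
  by rewrite (edge_eq vz jh zh vf zf) xf.
have big g : z \in ends g -> g != f -> s <= x g.
  by move=> zg gf; rewrite leNgt; apply/negP => xg; apply: nog; exists g.
have [e ve xe] := small v vz.
have ze : z \notin ends e.
  apply/negP => ze; have := big e ze; rewrite leNgt xe => /(_ _)/negP; apply=> //.
  by apply: contraNneq ve => ->.
have [j jv je] := end_ex ve; have jz : j != z by apply: contraNneq ze => <-.
have [e' eE] := edge_ex jv; exists e'; first by rewrite eE !inE negb_or !(eq_sym z) jz.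
apply: push_gt0; first by rewrite eE !inE negb_or !(eq_sym z) jz.
have [ve' je'] : v \in ends e' /\ j \in ends e' by rewrite eE !inE !eqxx orbT.
rewrite /pushed ltr_pwDl ?prodr_ge0 // => [|h _]; last exact: posp_ge0.
rewrite (bigD1 v) //= ltr_pwDl ?sumr_ge0 // mulr_gt0 //.
  rewrite /hollow (bigD1 e) /= ?ze ?ve ?(touchP je je') // ltr_pwDl //.
    by rewrite posp_gt0 subr_gt0.
  by apply: sumr_ge0 => h _; exact: posp_ge0.
rewrite prodr_gt0 // => h /andP[zh vh]; apply: lt_le_trans s0 (big h zh _).
by apply: contraNneq vh => ->.
Qed.

End Nonnegative.
End Deformation.

(** * The contraction *)

Section Contraction.
Variables (R : realType) (m : nat).
Hypothesis m_ge2 : (2 <= m)%N.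

Local Notation G := (complete_graph m.+1).
Local Notation E := (edge G).
Local Notation M := (matching_complex m.-1 G).
Local Notation X := (realization R M).
Implicit Types (x : E -> R) (e f g : E) (v w : 'I_m.+1) (s : R).

Let z : 'I_m.+1 := ord0.
(* Below the largest coordinate of any point of the realization. *)
Let eps : R := (#|E|.+1)%:R^-1.

Let eps_gt0 : 0 < eps. Proof. by rewrite invr_gt0 ltr0n. Qed.

(** Extends the flow to every real time, as the homotopy in [wedge_of_facets] requires. *)
Definition clamp s : R := Num.max 0 (Num.min 1 s).

(* Equal to 1 on [A], and 0 where all coordinates on some [F_v], [v <> z], are at
   least [eps]. *)
Definition cutoff x := \prod_(v | v != z)
  (1 - \prod_(e | v \notin ends e) Num.min 1 (x e / eps)).

(* [deform] can vanish identically only for [u = 1/2]; then [clamp s >= 1/2], so the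
   thickening has been completed. *)
Definition flow s x e :=
  deform (eps * Num.min 1 (2 * clamp s)) (clamp s * cutoff x) e x.

Lemma clamp_ge0 s : 0 <= clamp s. Proof. by rewrite le_max lexx. Qed.

Lemma clamp_le1 s : clamp s <= 1. Proof. by rewrite ge_max ler01 ge_min lexx. Qed.

Lemma clamp0 : clamp 0 = 0. Proof. by rewrite /clamp min_r // max_l. Qed.

Lemma clamp1 : clamp 1 = 1. Proof. by rewrite /clamp min_l // max_r. Qed.

Section Point.
Variable x : E -> R.
Hypothesis x_ge0 : forall e, 0 <= x e.

Let ratio_ge0 e : 0 <= Num.min 1 (x e / eps).
Proof. by rewrite le_min ler01 divr_ge0 // ltW. Qed.

Let ratios_ge0 v : 0 <= \prod_(e | v \notin ends e) Num.min 1 (x e / eps).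
Proof. exact: prodr_ge0. Qed.

Let ratios_le1 v : \prod_(e | v \notin ends e) Num.min 1 (x e / eps) <= 1.
Proof.
by apply: prodr_ile1 => e _; rewrite ratio_ge0 ge_min lexx.
Qed.

Lemma cutoff_ge0 : 0 <= cutoff x.
Proof. by apply: prodr_ge0 => v _; rewrite subr_ge0. Qed.

Lemma cutoff_le1 : cutoff x <= 1.
Proof.
apply: prodr_ile1 => v _; rewrite subr_ge0 ratios_le1 /=.
by rewrite gerBl.
Qed.

Lemma cutoff_facet_free : facet_free x -> cutoff x = 1.
Proof.
move=> xF; apply: big1 => v vz; have [e ve xe] := xF v vz.
by rewrite (bigD1 e) //= xe mul0r min_r // mul0r subr0.
Qed.

Lemma cutoff_gt0_small : 0 < cutoff x ->
  forall v, v != z -> exists2 e, v \notin ends e & x e < eps.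
Proof.
move=> cut0 v vz; apply: contrapT => nosmall; move: cut0.
rewrite /cutoff (bigD1 v) //= big1 ?subrr ?mul0r ?ltxx // => e ve.
rewrite min_l // ler_pdivlMr // mul1r leNgt; apply/negP => xe.
by apply: nosmall; exists e.
Qed.

Let time_ge0 s : 0 <= eps * Num.min 1 (2 * clamp s).
Proof. by rewrite mulr_ge0 ?(ltW eps_gt0) // le_min ler01 mulr_ge0 ?clamp_ge0. Qed.

Let flow_u_le1 s : clamp s * cutoff x <= 1.
Proof. by rewrite mulr_ile1 ?clamp_ge0 ?clamp_le1 ?cutoff_ge0 ?cutoff_le1. Qed.

Lemma flow_ge0 s e : 0 <= flow s x e.
Proof. exact: deform_ge0. Qed.

Hypotheses (x_sum : \sum_e x e = 1) (x_star : star_free x).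

Let large_coord : exists e, eps < x e.
Proof.
apply: contrapT => /forallNP small.
have : \sum_(e : E) x e <= \sum_(e : E) eps.
  by apply: ler_sum => e _; rewrite leNgt; apply/negP/small.
rewrite x_sum sumr_const -mulr_natr mulrC ler_pdivlMr ?ltr0n // mul1r ler_nat.
by rewrite ltnn.
Qed.

Lemma flow_pos s : exists e, 0 < flow s x e.
Proof.
rewrite /flow; set c := clamp s; set u := c * cutoff x.
have c1 : c <= 1 := clamp_le1 s.
have time_le : eps * Num.min 1 (2 * c) <= eps.
  by rewrite ler_piMr ?(ltW eps_gt0) // ge_min lexx.
have [u2|u2|uE] := ltgtP u 2^-1.
(* Before 1/2, a coordinate above [eps] survives the decrease by at most [eps]. *)
- have [e xe] := large_coord; exists e.
  have te : 0 < thicken (eps * Num.min 1 (2 * c)) e x.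
    rewrite /thicken ltr_pwDl //; first by rewrite posp_gt0 subr_gt0; lra.
    by case: ifP => // _; exact: pushed_ge0.
  rewrite /deform; case: ifP => _.
    by rewrite mulr_gt0 // posp_gt0; lra.
  rewrite ltr_pwDl ?posp_ge0 // mulr_gt0 // lt_min ltr01 /=; lra.
- have [e ze] := base_edge m_ge2; exists e.
  rewrite /deform (negbTE ze) ltr_wpDl //; last by rewrite posp_gt0; lra.
  rewrite mulr_ge0 ?thicken_ge0 // le_min ler01 /=.
  by have := flow_u_le1 s; rewrite -/c -/u; lra.
(* At exactly 1/2 only the edges off [z] remain, with no constant added; the completed thickening
   makes one of them positive. *)
have cut0 : 0 < cutoff x.
  rewrite lt0r cutoff_ge0 andbT; apply/eqP => cut0.
  by move: uE; rewrite /u cut0 mulr0; lra.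
have c2 : 2^-1 <= c.
  rewrite -uE /u ler_piMr ?cutoff_le1 //; exact: clamp_ge0.
have -> : eps * Num.min 1 (2 * c) = eps by rewrite min_l ?mulr1 //; lra.
have [e ze te] := thicken_base_gt0 x_ge0 x_star eps_gt0 (cutoff_gt0_small cut0).
exists e; rewrite /deform (negbTE ze) uE ltr_pwDl ?posp_ge0 // mulr_gt0 //.
by rewrite lt_min ltr01 /=; lra.
Qed.

Lemma flow_sum_gt0 s : 0 < \sum_e flow s x e.
Proof.
have [e fe] := flow_pos s.
by rewrite (bigD1 e) //= ltr_pwDl // sumr_ge0 // => f _; exact: flow_ge0.
Qed.

Lemma flow_star_free s : star_free (flow s x).
Proof. exact: deform_star_free. Qed.

Lemma flow_facet_free s : facet_free x -> facet_free (flow s x).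
Proof. exact: deform_facet_free. Qed.

Lemma flow0 e : flow 0 x e = x e.
Proof. by rewrite /flow clamp0 mul0r mulr0 min_r // mulr0 deform_id. Qed.

Lemma flow1 e : facet_free x -> flow 1 x e = (z \notin ends e)%:R.
Proof. by move=> xF; rewrite /flow cutoff_facet_free // clamp1 mul1r deform_end. Qed.

End Point.

Lemma barycentricP x : barycentric R M x <->
  [/\ forall e, 0 <= x e, \sum_e x e = 1 & star_free x].
Proof.
split=> [[x0 x1 /(star_matchingP m_ge2) xM]|[x0 x1 xM]]; split=> //.
  by move=> v; have [e ve] := xM v; rewrite inE negbK => /eqP; exists e.
apply/(star_matchingP m_ge2) => v; have [e ve xe] := xM v.
by exists e; rewrite // inE negbK xe.
Qed.

Definition normalize x e := x e / \sum_f x f.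

Lemma normalize_barycentric x : (forall e, 0 <= x e) -> 0 < \sum_e x e ->
  star_free x -> normalize x \in barycentric R M.
Proof.
move=> x0 xpos xM; apply/mem_set/barycentricP; split=> [e||v].
- by rewrite divr_ge0 // ltW.
- by rewrite -mulr_suml divff // gt_eqF.
- by have [e ve xe] := xM v; exists e => //; rewrite /normalize xe mul0r.
Qed.

Lemma flow_barycentric (p : X * R) :
  normalize (flow p.2 (set_val p.1)) \in barycentric R M.
Proof.
have [x0 x1 xM] := iffLR (barycentricP _) (@set_valP _ (barycentric R M) p.1).
apply: normalize_barycentric; [exact: flow_ge0|exact: flow_sum_gt0|].
exact: flow_star_free.
Qed.

Definition contraction (p : X * R) : X := SigSub (flow_barycentric p).

Lemma contractionE p e :
  set_val (contraction p) e = normalize (flow p.2 (set_val p.1)) e.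
Proof. by []. Qed.

Lemma contraction_cont : continuous contraction.
Proof.
apply: to_set_type_cont; apply: ptws_cont => e.
have coord f : continuous (fun p : X * R => set_val p.1 f).
  have fst_cont : continuous (fst : X * R -> X) by move=> p; exact: cvg_fst.
  exact: comp_continuous fst_cont (@coord_cont _ _ M f).
have clamp_cont : continuous (fun p : X * R => clamp p.2).
  apply: max_cont; first exact: cst_cont.
  by apply: min_cont; [exact: cst_cont|move=> p; exact: cvg_snd].
have cst (c : R) : continuous (fun p : X * R => c) by exact: cst_cont.
have cut_cont : continuous (fun p : X * R => cutoff (set_val p.1)).
  apply: prod_cont => v; apply: sub_cont => //; apply: prod_cont => f.
  by apply: min_cont => //; exact: mul_cont.
have time_cont : continuous (fun p : X * R => eps * Num.min 1 (2 * clamp p.2)).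
  by apply: mul_cont => //; apply: min_cont => //; exact: mul_cont.
have u_cont : continuous (fun p : X * R => clamp p.2 * cutoff (set_val p.1)).
  exact: mul_cont.
have posp_cont (f : X * R -> R) : continuous f -> continuous (fun p => posp (f p)).
  by move=> cf; exact: max_cont.
have flow_cont f : continuous (fun p : X * R => flow p.2 (set_val p.1) f).
  have pushed_cont : continuous (fun p : X * R =>
      pushed (eps * Num.min 1 (2 * clamp p.2)) f (set_val p.1)).
    apply: add_cont.
      apply: sum_cont => v; apply: mul_cont; last by apply: prod_cont.
      by apply: sum_cont => g; apply: posp_cont; exact: sub_cont.
    by apply: prod_cont => g; apply: posp_cont; exact: sub_cont.
  have thicken_cont : continuous (fun p : X * R =>
      thicken (eps * Num.min 1 (2 * clamp p.2)) f (set_val p.1)).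
    rewrite /thicken; apply: add_cont; first by apply: posp_cont; exact: sub_cont.
    by case: (z \in ends f).
  rewrite /flow /deform -/z; case: (z \in ends f).
    apply: mul_cont => //; apply: posp_cont; apply: sub_cont => //; exact: mul_cont.
  apply: add_cont.
    by apply: mul_cont => //; apply: min_cont => //; apply: sub_cont => //; exact: mul_cont.
  by apply: posp_cont; apply: sub_cont => //; exact: mul_cont.
apply: div_cont => // [p|]; last exact: sum_cont.
have [x0 x1 xM] := iffLR (barycentricP _) (@set_valP _ (barycentric R M) p.1).
by rewrite gt_eqF // flow_sum_gt0.
Qed.

End Contraction.

(** * The facets F_v of the matching complex and the resulting wedge *)

Section Main.
Variables (R : realType) (m t : nat).
Hypothesis m_ge2 : (2 <= m)%N.
Hypothesis tE : t.+1 = 'C(m, 2).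

Local Notation G := (complete_graph m.+1).
Local Notation E := (edge G).
Local Notation M := (matching_complex m.-1 G).

(** [lift ord0 i] runs over the vertices other than the fixed vertex [ord0], whose facet belongs to
    the subcomplex to be contracted. *)
Definition avoiding (i : 'I_m) := [set e : E | lift ord0 i \notin ends e]%SET.

Lemma card_avoiding i : t.+1 = #|avoiding i|.
Proof. by rewrite card_edges_avoiding. Qed.

Definition facet_enum (i : 'I_m) (j : 'I_t.+1) : E :=
  enum_val (cast_ord (card_avoiding i) j).

Lemma facet_enum_inj i : injective (facet_enum i).
Proof. by move=> j j' /enum_val_inj/cast_ord_inj. Qed.

Lemma codom_facet_enum i e :
  (e \in codom (facet_enum i)) = (lift ord0 i \notin ends e).
Proof.
apply/codomP/idP => [[j ->]|ie].
  by have := enum_valP (cast_ord (card_avoiding i) j); rewrite inE.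
have ieA : e \in avoiding i by rewrite inE.
exists (cast_ord (esym (card_avoiding i)) (enum_rank_in ieA e)).
by rewrite /facet_enum cast_ordKV enum_rankK_in.
Qed.

Lemma facet_boundary_facet_free (x : realization R M) :
  facet_boundary facet_enum x <-> facet_free (set_val x).
Proof.
split=> [Ax v v0|xF i].
  have [i -> ] : exists i : 'I_m, v = lift ord0 i.
    by case: (unliftP ord0 v) v0 => [i ->|->]; [exists i|rewrite eqxx].
  have [j xj] := Ax i; exists (facet_enum i j) => //.
  by rewrite -codom_facet_enum codom_f.
have i0 : lift ord0 i != ord0 by rewrite eq_sym neq_lift.
have [e] := xF _ i0; rewrite -codom_facet_enum => /codomP[j ->] xj.
by exists j.
Qed.

(** The missing edge at [v] joins it to the omitted vertex, or to any other vertex when [v] is the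
    omitted one. *)
Lemma facet_enum_face i : [set e in codom (facet_enum i)]%SET \in face M.
Proof.
apply/(star_matchingP m_ge2) => v.
have [u uv ui] : exists2 u, u != v & lift ord0 i \in [set u; v]%SET.
  have [<-|iv] := eqVneq (lift ord0 i) v.
    have [u ui _] := third_vertex m_ge2 (lift ord0 i) v.
    by exists u; rewrite ?inE ?eqxx ?orbT.
  by exists (lift ord0 i); rewrite ?inE ?eqxx.
have [e eE] := edge_ex uv; exists e; first by rewrite eE !inE eqxx orbT.
by rewrite inE codom_facet_enum eE ui.
Qed.

(* An additional edge would join the omitted vertex to some [w], which would then
   have full degree. *)
Lemma facet_enum_facet i (s : {set E}) : s \in face M ->
  (forall j, facet_enum i j \in s) -> s = [set e in codom (facet_enum i)]%SET.
Proof.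
move=> /(star_matchingP m_ge2) sM sF.
have sF' e : lift ord0 i \notin ends e -> e \in s.
  by rewrite -codom_facet_enum => /codomP[j ->].
apply/setP => e; rewrite inE codom_facet_enum; apply/idP/idP; last exact: sF'.
move=> es; apply/negP => ie; have [w wi we] := other_end ie.
have [f wf] := sM w; apply/negP; rewrite negbK.
have [fi|/sF'//] := boolP (lift ord0 i \in ends f).
by rewrite (edge_eq wi wf fi we ie).
Qed.

(** For distinct indices, an edge from the second omitted vertex to a third vertex lies in the first
    facet only. *)
Lemma facet_enum_distinct i i' :
  (forall j, facet_enum i j \in codom (facet_enum i')) -> i = i'.
Proof.
move=> ii'; apply/eqP; apply/negPn/negP => neq.
have lneq : lift ord0 i' != lift ord0 i.
  by rewrite (inj_eq (@lift_inj _ _)) eq_sym.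
have [w wi wi'] := third_vertex m_ge2 (lift ord0 i) (lift ord0 i').
have [e eE] := edge_ex wi'.
have : e \in codom (facet_enum i).
  by rewrite codom_facet_enum eE !inE negb_or !(eq_sym (lift ord0 i)) wi.
case/codomP => j eF; have := ii' j; rewrite -eF codom_facet_enum eE.
by rewrite !inE eqxx orbT.
Qed.

Theorem matching_complex_wedge :
  homotopy_equivalent R (realization R M) (wedge_of_spheres R m t).
Proof.
(* The value of the flow at time 1 on the subcomplex; normalized, it is the point to which the
   subcomplex contracts. *)
pose base (e : E) : R := (ord0 \notin ends e)%:R.
have base_ge0 e : 0 <= base e by rewrite ler0n.
have base_eq0 e : ord0 \in ends e -> base e = 0 by rewrite /base => ->.
have base_sum : 0 < \sum_e base e.
  have [e ze] := base_edge m_ge2.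
  by rewrite (bigD1 e) //= /base ze ltr_pwDl ?sumr_ge0 // => f _; rewrite ler0n.
have base_star : star_free base.
  by move=> v; have [e ve ze] := apex_edge m_ge2 v; exists e; rewrite ?base_eq0.
pose a : realization R M :=
  SigSub (normalize_barycentric m_ge2 base_ge0 base_sum base_star).
have Aa : facet_boundary facet_enum a.
  apply/facet_boundary_facet_free => v v0.
  have [e ve ze] := avoiding_apex_edge m_ge2 v0; exists e => //.
  have aE : set_val a e = normalize base e by [].
  by rewrite aE /normalize base_eq0 // mul0r.
have pt (x : realization R M) : [/\ forall e, 0 <= set_val x e,
    \sum_e set_val x e = 1 & star_free (set_val x)].
  exact: iffLR (barycentricP m_ge2 _) (@set_valP _ (barycentric R M) x).
apply: (wedge_of_facets (en := facet_enum) _ _ _ _ _ Aa (@contraction_cont R m m_ge2)).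
- exact: ltn_trans m_ge2.
- exact: facet_enum_inj.
- exact: facet_enum_face.
- exact: facet_enum_facet.
- exact: facet_enum_distinct.
- move=> x; apply: val_inj; apply: funext => e.
  have [x0 x1 _] := pt x; rewrite [LHS](contractionE m_ge2) /normalize.
  under eq_bigr do rewrite (flow0 m_ge2 x0).
  by rewrite (flow0 m_ge2 x0) x1 divr1.
- move=> x s /facet_boundary_facet_free xF; apply/facet_boundary_facet_free.
  have [x0 x1 xM] := pt x.
  move=> v v0; have [e ve xe] := flow_facet_free m_ge2 xM s xF v0.
  by exists e => //; rewrite (contractionE m_ge2) /normalize xe mul0r.
- move=> x /facet_boundary_facet_free xF.
  have [x0 x1 xM] := pt x; apply: val_inj; apply: funext => e.
  rewrite [LHS](contractionE m_ge2) /normalize; under eq_bigr do rewrite flow1 //.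
  by rewrite flow1.
Qed.

End Main.

Theorem theorem1p1 (R : realType) (n : nat) (hn : (3 <= n)%N) :
  homotopy_equivalent R
    (realization R (matching_complex (n - 2) (complete_graph n)))
    (wedge_of_spheres R (n - 1) ('C(n - 1, 2) - 1)).
Proof.
(* With n = m + 1, the binomial of m over 2 is positive because m >= 2, so the truncated subtraction
   in the dimension is exact. *)
case: n hn => // m m_ge2; rewrite subSS subn1 -[(m.+1 - 1)%N]/(m - 0)%N subn0.
apply: matching_complex_wedge => //.
by rewrite subn1 prednK // bin_gt0.
Qed.
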